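(* Let $r\ge0$ be an integer, $l=r+1$ or $l=r+2$, and $q\ge1$ an integer. Let $\mathcal{D}_x$ be the optimally accurate first-derivative finite-difference operator with stencil $(l,r)$ and $\mathcal{D}_{xx}$ the optimally accurate second-derivative finite-difference operator with centered stencil $q$. Let an explicit Runge-Kutta method of order $m\ge 1$ be given. Then there exist positive numbers $\alpha_0,\beta_0,\gamma_0$, depending only on $\mathcal{D}_x$, $\mathcal{D}_{xx}$ and the Runge-Kutta method (in particular not on $\nu$, $h$, $\delta t$), such that for every $\nu>0$, every $h=1/N$ with $N$ a positive integer, and every $\delta t>0$ satisfying $$\delta t<\nu\gamma_0\quad\text{and}\quad\left(\alpha_0+\frac{\nu\beta_0}{h}\right)\frac{\delta t}{h}<1,$$ the fully-discretized method for $w_t+w_x-\nu w_{xx}=0$ with periodic boundary conditions on $[0,1]$ is stable.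
   Context: Spatial discretization: on $N$ uniform cells of $[0,1]$, $h=1/N$, $\mathcal{D}_xw_j=\frac1h\sum_{k=-l}^r a_kw_{j+k}$ and $\mathcal{D}_{xx}w_j=\frac1{h^2}\sum_{k=-q}^q b_kw_{j+k}$ (indices modulo $N$). The optimally accurate operators are those with coefficients $$a_k=-\frac{(-1)^k}{k}\frac{l!\,r!}{(l+k)!\,(r-k)!}\ (-l\le k\le r,\ k\neq0),\qquad a_0=-\sum_{-l\le k\le r,\,k\ne0}\frac1k,$$ $$b_k=-\frac{2(-1)^k}{k^2}\frac{q!\,q!}{(q+k)!\,(q-k)!}\ (-q\le k\le q,\ k\ne0),\qquad b_0=-\sum_{k=1}^q\frac{2}{k^2}.$$ With $\boldsymbol{S}$ the $N\times N$ cyclic shift matrix, $(\boldsymbol{S}\boldsymbol{W})_j=w_{j+1}$ (indices modulo $N$), put $\boldsymbol{A}=\sum_{k=-l}^r a_k\boldsymbol{S}^k$, $\boldsymbol{B}=\sum_{k=-q}^q b_k\boldsymbol{S}^k$, $R=\nu/h$, $\boldsymbol{M}=-\boldsymbol{A}+R\boldsymbol{B}$. The semi-discretized system is $\frac{d\boldsymbol{W}}{dt}=\frac1h\boldsymbol{M}\boldsymbol{W}$. Time integration: an explicit Runge-Kutta method with $s$ stages has real coefficients $\hat a_{ij}$ ($1\le j<i\le s$) and $\hat b_j$ ($1\le j\le s$) with $\sum_j\hat b_j=1$. Applied to the system above with step $\delta t$ and $\mu=\delta t/h$ it yields $\boldsymbol{W}^{n+1}=p_s(\mu\boldsymbol{M})\boldsymbol{W}^n$,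 where $p_0(z)=1$, $p_{i-1}(z)=1+\sum_{j=1}^{i-1}\hat a_{ij}z\,p_{j-1}(z)$ for $2\le i\le s$, and $p_s(z)=1+\sum_{j=1}^s\hat b_jz\,p_{j-1}(z)$. If the method has order $m$ then $p_s(z)=\sum_{k=0}^m z^k/k!+O(z^{m+1})$ as $z\to0$. The fully-discretized method with given $h,\delta t$ (and $\nu$) is stable if the powers $[p_s(\mu\boldsymbol{M})]^n$, $n\ge0$, are bounded, i.e. every numerical solution $\boldsymbol{W}^n=[p_s(\mu\boldsymbol{M})]^n\boldsymbol{W}^0$ stays bounded as $n\to\infty$. *)

(* Defs.v *)
From HB Require Import structures.
From mathcomp Require Import all_boot all_order all_algebra.
From mathcomp Require Import all_classical all_reals all_analysis.
Set Implicit Arguments.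
Unset Strict Implicit.
Unset Printing Implicit Defensive.
Import Order.TTheory GRing.Theory Num.Theory.
Import numFieldNormedType.Exports.
Local Open Scope classical_set_scope.
Local Open Scope ring_scope.

(* The sum of F k over the integers k with - l <= k <= r.                     *)
Definition stencil_sum (V : nmodType) (l r : nat) (F : int -> V) : V :=
  \sum_(i < (l + r).+1) F (i%:Z - l%:Z).

(* The factorial arguments l + k and r - k are nonnegative on the stencil,    *)
(* so taking absolute values only serves to return to nat.                    *)
Definition a_coef (R : realType) (l r : nat) (k : int) : R :=
  if k == 0 then - stencil_sum l r (fun j : int => if j == 0 then 0 else j%:~R^-1)
  else - ((-1) ^ k / k%:~R) *
       (l`!%:R * r`!%:R / ((absz (l%:Z + k))`!%:R * (absz (r%:Z - k))`!%:R)).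

Definition b_coef (R : realType) (q : nat) (k : int) : R :=
  if k == 0 then - \sum_(1 <= j < q.+1) 2 / j%:R ^+ 2
  else - (2 * (-1) ^ k / k%:~R ^+ 2) *
       (q`!%:R * q`!%:R / ((absz (q%:Z + k))`!%:R * (absz (q%:Z - k))`!%:R)).

(* Grids have N = n.+1 cells; (S W)_j = w_{j+1 mod N}.  The matrix S is       *)
(* invertible, so that S ^ k with k < 0 is a genuine power of its inverse.    *)
Definition shift_mx (R : realType) (n : nat) : 'M[R]_n.+1 :=
  \matrix_(i, j) (j == ordS i)%:R.

Definition A_mx (R : realType) (l r n : nat) : 'M[R]_n.+1 :=
  stencil_sum l r (fun k => a_coef R l r k *: shift_mx R n ^ k).

Definition B_mx (R : realType) (q n : nat) : 'M[R]_n.+1 :=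
  stencil_sum q q (fun k => b_coef R q k *: shift_mx R n ^ k).

Definition M_mx (R : realType) (l r q n : nat) (nu h : R) : 'M[R]_n.+1 :=
  - A_mx R l r n + (nu / h) *: B_mx R q n.

(* Stages are numbered from 0, i.e. the usual coefficients \hat a_{ij} and    *)
(* \hat b_j are rk_a i.-1 j.-1 and rk_b j.-1.  Only the values rk_a i j with  *)
(* j < i < rk_s and rk_b j with j < rk_s are ever used.                       *)
Record explicit_RK (R : realType) := ExplicitRK {
  rk_s : nat;
  rk_a : nat -> nat -> R;
  rk_b : nat -> R;
  rk_sum_b : \sum_(j < rk_s) rk_b j = 1
}.

(* The stage values Y_0, ..., Y_{i-1} of one step of size dt from y for       *)
(* y' = f(y): Y_i = y + dt \sum_(j < i) \hat a_{ij} f(Y_j).                   *)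
Fixpoint rk_stages (R : realType) (rk : explicit_RK R) (V : lmodType R)
    (f : V -> V) (dt : R) (y : V) (i : nat) : seq V :=
  if i is i'.+1 then
    let Y := rk_stages rk f dt y i' in
    rcons Y (y + dt *: \sum_(j < i') rk_a rk i' j *: f Y`_j)
  else [::].

Definition rk_step (R : realType) (rk : explicit_RK R) (V : lmodType R)
    (f : V -> V) (dt : R) (y : V) : V :=
  let Y := rk_stages rk f dt y (rk_s rk) in
  y + dt *: \sum_(j < rk_s rk) rk_b rk j *: f Y`_j.

(* p_0, ..., p_{i-1}, with p_s given by stab_poly below.                      *)
Fixpoint stage_polys (R : realType) (rk : explicit_RK R) (i : nat) :
    seq {poly R} :=
  if i is i'.+1 then
    let p := stage_polys rk i' in
    rcons p (1 + \sum_(j < i') rk_a rk i' j *: ('X * p`_j))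
  else [::].

Definition stab_poly (R : realType) (rk : explicit_RK R) : {poly R} :=
  let p := stage_polys rk (rk_s rk) in
  1 + \sum_(j < rk_s rk) rk_b rk j *: ('X * p`_j).

(* Iterated directional derivatives; f is C^oo when all of them exist and are *)
(* continuous.                                                                *)
Fixpoint iter_derive (R : realType) (V : normedModType R) (f : V -> V)
    (vs : seq V) : V -> V :=
  if vs is v :: vs' then (fun x => 'D_v (iter_derive f vs') x) else f.

Definition smooth (R : realType) (V : normedModType R) (f : V -> V) : Prop :=
  forall vs : seq V, continuous (iter_derive f vs) /\
    forall x v : V, derivable (iter_derive f vs) x v.

(* Order (at least) m: the local error is O(dt^(m+1)) along every solution of *)
(* every smooth autonomous system y' = f(y).                                  *)
Definition has_order (R : realType) (rk : explicit_RK R) (m : nat) : Prop :=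
  forall (d : nat) (f : 'cV[R]_d.+1 -> 'cV[R]_d.+1) (y : R -> 'cV[R]_d.+1),
    smooth f ->
    (\forall t \near (0 : R), is_derive t (1 : R) y (f (y t))) ->
    exists C : R, \forall dt \near (0 : R)^'+,
      `|y dt - rk_step rk f dt (y 0)| <= C * dt ^+ m.+1.

Definition stable (R : realType) (rk : explicit_RK R) (l r q n : nat)
    (nu h dt : R) : Prop :=
  let P := horner_mx ((dt / h) *: M_mx l r q n nu h) (stab_poly rk) in
  exists C : R, forall k : nat, `|P ^+ k| <= C.

(* Relates the general step, which defines the order, to the amplification    *)
(* matrix p_s((dt/h) M), which defines stability.                             *)
Lemma rk_step_linear (R : realType) (rk : explicit_RK R) (n : nat)
    (M : 'M[R]_n.+1) (h dt : R) (W : 'cV[R]_n.+1) :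
  rk_step rk (fun U => h^-1 *: (M *m U)) dt W =
  horner_mx ((dt / h) *: M) (stab_poly rk) *m W.
Proof.
set f := fun U => _; set Z := _ *: M.
have step (c : nat -> R) i (Y : seq 'cV[R]_n.+1) (p : seq {poly R}) :
    Y = [seq horner_mx Z u *m W | u <- p] -> size p = i ->
    W + dt *: (\sum_(j < i) c j *: f Y`_j) =
    horner_mx Z (1 + \sum_(j < i) c j *: ('X * p`_j)) *m W.
  move=> -> sp; rewrite rmorphD rmorph1 mulmxDl mul1mx; congr (_ + _).
  rewrite rmorph_sum mulmx_suml scaler_sumr; apply: eq_bigr => j _.
  rewrite (nth_map 0) ?sp// /f /= horner_mxZ rmorphM/= horner_mx_X.
  rewrite -mulmxE -scalemxAl -mulmxA -[Z *m _]scalemxAl !scalerA.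
  by congr (_ *: _); rewrite mulrCA -mulrA.
have sz i : size (stage_polys rk i) = i.
  by elim: i => //= i IH; rewrite size_rcons IH.
have stagesE i : rk_stages rk f dt W i =
    [seq horner_mx Z u *m W | u <- stage_polys rk i].
  by elim: i => //= i IH; rewrite map_rcons -(step _ _ _ _ IH (sz i)) IH.
exact: step (stagesE _) (sz _).
Qed.

(* Main.v *)
(* Energy method in the Euclidean norm. Write D = 1 - S. Comparing coefficients
   with those of (D^T D)^j = (-1)^j S^-j (1 - S)^(2j) gives, for all u,
     <u, A u> = c |D^l u|^2 with c >= 0,
     <u, B u> = - sum_(1 <= j <= q) 2 ((j-1)!)^2 / (2j)! |D^j u|^2 <= - |D u|^2,
   and consistency (the coefficients sum to 0) bounds |A u|^2 and |B u|^2 by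
   constant multiples of |D u|^2, uniformly in N. As sum_j b_j = 1, the stability
   polynomial is 1 + X + X^2 g, so for Z = mu M, normal and contracting,
     |p(Z) u|^2 <= |u|^2 + 2 <u, Z u> + K |Z u|^2,
   and under the step size restrictions the dissipation - 2 mu R |D u|^2 in the
   second term absorbs the third one. *)
Require Import Defs.
From mathcomp Require Import all_boot all_order all_algebra.
From mathcomp Require Import all_classical all_reals all_analysis.
From mathcomp Require Import zify ring lra.
Import Order.TTheory GRing.Theory Num.Theory.
Local Open Scope ring_scope.

Set Implicit Arguments.
Unset Strict Implicit.
Unset Printing Implicit Defensive.

(** * Euclidean inner product and squared norm of column vectors *)

Definition dot (R : realType) n (u v : 'cV[R]_n) : R := (u^T *m v) 0 0.

Definition sqn (R : realType) n (u : 'cV[R]_n) : R := dot u u.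

Lemma dotE (R : realType) n (u v : 'cV[R]_n) :
  dot u v = \sum_i u i 0 * v i 0.
Proof. by rewrite /dot mxE; apply: eq_bigr => i _; rewrite mxE. Qed.

Lemma dotC (R : realType) n (u v : 'cV[R]_n) : dot u v = dot v u.
Proof. by rewrite !dotE; apply: eq_bigr => i _; rewrite mulrC. Qed.

Lemma dotDr (R : realType) n (u v w : 'cV[R]_n) :
  dot u (v + w) = dot u v + dot u w.
Proof. by rewrite /dot mulmxDr mxE. Qed.

Lemma dotZr (R : realType) n (c : R) (u v : 'cV[R]_n) :
  dot u (c *: v) = c * dot u v.
Proof. by rewrite /dot -scalemxAr mxE. Qed.

Lemma dotNr (R : realType) n (u v : 'cV[R]_n) : dot u (- v) = - dot u v.
Proof. by rewrite -scaleN1r dotZr mulN1r. Qed.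

Lemma dot_sumr (R : realType) n m (u : 'cV[R]_n) (F : 'I_m -> 'cV[R]_n) :
  dot u (\sum_i F i) = \sum_i dot u (F i).
Proof. by rewrite /dot mulmx_sumr summxE. Qed.

Lemma dotDl (R : realType) n (u v w : 'cV[R]_n) :
  dot (u + v) w = dot u w + dot v w.
Proof. by rewrite dotC dotDr !(dotC w). Qed.

Lemma dot_mull (R : realType) n (A : 'M[R]_n) (u v : 'cV[R]_n) :
  dot (A *m u) v = dot u (A^T *m v).
Proof. by rewrite /dot trmx_mul mulmxA. Qed.

Lemma sqn_ge0 (R : realType) n (u : 'cV[R]_n) : 0 <= sqn u.
Proof. by rewrite /sqn dotE sumr_ge0 // => i _; rewrite -expr2 sqr_ge0. Qed.

Lemma sqnD (R : realType) n (u v : 'cV[R]_n) :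
  sqn (u + v) = sqn u + 2 * dot u v + sqn v.
Proof. by rewrite /sqn !(dotDr, dotDl) (dotC v u); ring. Qed.

Lemma sqnZ (R : realType) n (c : R) (u : 'cV[R]_n) :
  sqn (c *: u) = c ^+ 2 * sqn u.
Proof. by rewrite /sqn dotZr dotC dotZr; ring. Qed.

Lemma sqnN (R : realType) n (u : 'cV[R]_n) : sqn (- u) = sqn u.
Proof. by rewrite -scaleN1r sqnZ sqrrN expr1n mul1r. Qed.

Lemma dot_le_sqn (R : realType) n (u v : 'cV[R]_n) :
  2 * dot u v <= sqn u + sqn v.
Proof.
by have := sqn_ge0 (u - v); rewrite sqnD sqnN dotNr; lra.
Qed.

Lemma sqnD_le (R : realType) n (u v : 'cV[R]_n) :
  sqn (u + v) <= 2 * sqn u + 2 * sqn v.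
Proof. by rewrite sqnD; have := dot_le_sqn u v; lra. Qed.

(** * Norm estimates with constants independent of the dimension *)

(** The constant is fixed before the dimension and the vectors, so that stencil bounds built on it
    are uniform in the grid. The number of terms being fixed, iterating |u + v|^2 <= 2 |u|^2 + 2
    |v|^2 is enough. *)
Lemma sqn_sum_le (R : realType) m (c K : nat -> R) :
  (forall i, 0 <= K i) ->
  exists2 C : R, 0 <= C & forall n (u : nat -> 'cV[R]_n) (X : R),
    (forall i, (i < m)%N -> sqn (u i) <= K i * X) ->
    sqn (\sum_(i < m) c i *: u i) <= C * X.
Proof.
move=> K0; elim: m => [|m [C C0 IH]].
  by exists 0 => // n u X _; rewrite big_ord0 /sqn -(scale0r 0) dotZr !mul0r.
exists (2 * C + 2 * (c m ^+ 2 * K m)) => [|n u X hu].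
  by apply: addr_ge0; do ?[exact: sqr_ge0 | apply: mulr_ge0].
rewrite big_ord_recr /=; apply: (le_trans (sqnD_le _ _)).
rewrite [leRHS]mulrDl; apply: lerD; rewrite -mulrA ler_pM2l //.
  by apply: IH => i im; apply: hu; apply: ltnW.
by rewrite sqnZ -[leRHS]mulrA ler_wpM2l ?sqr_ge0 // hu.
Qed.

(** Horner's scheme: p X + c costs at most 2 |p(Z) Z u|^2 + 2 c^2 |u|^2, and Z does not increase
    norms. [G] depends on [g] alone, so the step size constants can be chosen before nu, h and
    dt. *)
Lemma sqn_horner_le (R : realType) (g : {poly R}) :
  exists2 G : R, 0 <= G & forall n (Z : 'M[R]_n.+1),
    (forall u : 'cV_n.+1, sqn (Z *m u) <= sqn u) ->
    forall u : 'cV_n.+1, sqn (horner_mx Z g *m u) <= G * sqn u.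
Proof.
elim/poly_ind: g => [|p c [G G0 IH]].
  exists 0 => // n Z _ u.
  by rewrite rmorph0 mul0mx /sqn -(scale0r 0) dotZr !mul0r.
exists (2 * G + 2 * c ^+ 2) => [|n Z hZ u].
  by apply: addr_ge0; do ?[exact: sqr_ge0 | apply: mulr_ge0].
rewrite rmorphD rmorphM /= horner_mx_X horner_mx_C mulmxDl mul_scalar_mx.
apply: (le_trans (sqnD_le _ _)).
rewrite [leRHS]mulrDl; apply: lerD; rewrite -mulrA ler_pM2l ?sqnZ //.
rewrite -mulmxE -mulmxA; apply: (le_trans (IH _ _ hZ _)).
by rewrite ler_wpM2l.
Qed.

(* For p = 1 + X + X^2 g and Z normal, the quadratic terms of |p(Z) u|^2 all
   reduce to |Z u|^2, since <u, Z^2 v> = <Z^T u, Z v> and |Z^T u| = |Z u|. *)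
Lemma sqn_normal_step (R : realType) n (Z : 'M[R]_n.+1) (g : {poly R}) (G : R)
    (u : 'cV[R]_n.+1) :
  GRing.comm Z Z^T ->
  (forall v : 'cV_n.+1, sqn (Z *m v) <= sqn v) ->
  (forall v : 'cV_n.+1, sqn (horner_mx Z g *m v) <= G * sqn v) ->
  sqn (horner_mx Z (1 + 'X + 'X^2 * g) *m u) <=
  sqn u + 2 * dot u (Z *m u) + 3 * (1 + G) * sqn (Z *m u).
Proof.
move=> ZC hZ hg.
set v := horner_mx Z g *m (Z *m u).
have -> : horner_mx Z (1 + 'X + 'X^2 * g) *m u = u + (Z *m u + Z *m v).
  rewrite !rmorphD /= rmorphM rmorphXn /= rmorph1 horner_mx_X.
  rewrite !mulmxDl mul1mx -addrA; do 2!congr (_ + _).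
  rewrite /v expr2 -mulrA -!mulmxE -!mulmxA; congr (_ *m _).
  rewrite !mulmxA; congr (_ *m _).
  exact/esym/(comm_horner_mx g (erefl (Z *m Z))).
have Zt : sqn (Z^T *m u) = sqn (Z *m u).
  by rewrite /sqn !dot_mull trmxK !mulmxA; congr (dot _ (_ *m _)).
have h1 : 2 * dot u (Z *m v) <= sqn (Z *m u) + G * sqn (Z *m u).
  rewrite -[Z in Z *m v]trmxK -dot_mull; apply: (le_trans (dot_le_sqn _ _)).
  by rewrite Zt lerD // hg.
have h2 := sqnD_le (Z *m u) (Z *m v).
have h3 := hZ v; have h4 := hg (Z *m u).
rewrite sqnD dotDr; move: h4; rewrite -/v; nra.
Qed.

(** The matrix norm is the largest absolute entry. Entry (i, j) of P^k is a coordinate of P^k e_j,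
    whose Euclidean length is at most |e_j| = 1. *)
Lemma mx_norm_powers (R : realType) n (P : 'M[R]_n.+1) :
  (forall u : 'cV_n.+1, sqn (P *m u) <= sqn u) ->
  exists C : R, forall k : nat, `|P ^+ k| <= C.
Proof.
move=> hP; exists 1 => k.
have hPk (u : 'cV_n.+1) : sqn (P ^+ k *m u) <= sqn u.
  elim: k u => [|k IH] u; first by rewrite expr0 mul1mx.
  by rewrite exprS -mulmxE -mulmxA; apply: (le_trans (hP _)).
rewrite /Num.norm /= mx_normrE.
apply: bigmax_le => //= -[i j] _ /=.
rewrite -(@ler_pXn2r _ 2) ?nnegrE // expr1n real_normK ?num_real //.
have e1 : sqn (delta_mx j 0 : 'cV[R]_n.+1) = 1.
  rewrite /sqn dotE (bigD1 j) //= big1 ?addr0 ?mxE ?eqxx ?mul1r //.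
  by move=> a aj; rewrite mxE (negbTE aj) mul0r.
have := hPk (delta_mx j 0); rewrite e1 -colE; apply: le_trans.
rewrite /sqn dotE (bigD1 i) //= !mxE expr2 lerDl sumr_ge0 // => a _.
by rewrite -expr2 sqr_ge0.
Qed.

(** * Low-order terms of the stability polynomial *)

(** Every stage polynomial has constant term 1, so the coefficient of X is the sum of the weights
    b_j, which is 1. *)
Lemma stab_polyE (R : realType) (rk : explicit_RK R) :
  exists g, stab_poly rk = 1 + 'X + 'X^2 * g.
Proof.
have stageE i : exists c : nat -> {poly R},
    forall j, (j < i)%N -> (stage_polys rk i)`_j = 1 + 'X * c j.
  have sz k : size (stage_polys rk k) = k.
    by elim: k => //= k IH; rewrite size_rcons IH.
  elim: i => [|i [c IH]]; first by exists (fun=> 0).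
  exists (fun j => if (j < i)%N then c j else
    \sum_(j < i) rk_a rk i j *: (stage_polys rk i)`_j) => j.
  rewrite ltnS leq_eqVlt /= nth_rcons sz => /orP[/eqP->|ji].
    rewrite ltnn eqxx; congr (_ + _); rewrite mulr_sumr.
    by apply: eq_bigr => k _; rewrite scalerAr.
  by rewrite ji IH.
have [c cE] := stageE (rk_s rk).
exists (\sum_(j < rk_s rk) rk_b rk j *: c j).
rewrite /stab_poly -addrA; congr (_ + _).
have XE : \sum_(j < rk_s rk) rk_b rk j *: 'X = 'X :> {poly R}.
  by rewrite -scaler_suml rk_sum_b scale1r.
rewrite -[X in _ = X + _]XE mulr_sumr -big_split; apply: eq_bigr => j _ /=.
by rewrite cE // mulrDr mulr1 scalerDr mulrA -expr2 scalerAr.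
Qed.

(** * Stencil sums and the cyclic shift *)

Lemma stencil_sum_split (V : nmodType) (l r : nat) (F : int -> V) :
  stencil_sum l r F = F 0 + \sum_(1 <= k < r.+1) F k%:Z
                          + \sum_(1 <= k < l.+1) F (- k%:Z).
Proof.
elim: l => [|l IH].
  rewrite /stencil_sum [\sum_(1 <= k < 1) _]big_nil addr0 big_ord_recl.
  rewrite subr0; congr (_ + _).
  rewrite big_add1 big_mkord; apply: eq_bigr => i _.
  by rewrite subr0.
rewrite [X in _ + X]big_nat_recr //= addrA -IH /stencil_sum addSn big_ord_recl addrC /=.
congr (_ + F _); last by rewrite sub0r.
by apply: eq_bigr => i _; congr F; rewrite /bump; lia.
Qed.

Lemma eq_stencil_sum (V : nmodType) (l r : nat) (F G : int -> V) :
  (forall k, - l%:Z <= k <= r%:Z -> F k = G k) ->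
  stencil_sum l r F = stencil_sum l r G.
Proof. by move=> FG; apply: eq_bigr => i _; apply: FG; have := ltn_ord i; lia. Qed.

Lemma shift_mx_tr (R : realType) n : shift_mx R n *m (shift_mx R n)^T = 1%:M.
Proof.
apply/matrixP => i j; rewrite !mxE (bigD1 (ordS i)) //= big1 ?addr0.
  by rewrite !mxE eqxx mul1r (inj_eq (@ordS_inj _)).
by move=> k ki; rewrite !mxE (negbTE ki) mul0r.
Qed.

Lemma shift_mx_unit (R : realType) n : shift_mx R n \is a GRing.unit.
Proof. by have [] := mulmx1_unit (shift_mx_tr R n). Qed.

Lemma shift_mxV (R : realType) n : (shift_mx R n)^-1 = (shift_mx R n)^T.
Proof.
have := shift_mx_tr R n; rewrite mulmxE => h.
by rewrite -[LHS]mulr1 -[1 in LHS]/(1%:M) -h mulKr // shift_mx_unit.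
Qed.

Lemma trmx_exp (R : comPzRingType) n (A : 'M[R]_n.+1) (m : nat) :
  (A ^+ m)^T = A^T ^+ m.
Proof.
elim: m => [|m IH]; first by rewrite !expr0 trmx1.
by rewrite exprS -mulmxE trmx_mul IH mulmxE exprSr.
Qed.

Lemma shift_mxz_tr (R : realType) n (k : int) :
  (shift_mx R n ^ k)^T = shift_mx R n ^ (- k).
Proof.
rewrite -exprz_inv shift_mxV; case: k => m; first exact: trmx_exp.
by rewrite /exprz -[X in X^T]/(invmx (_ ^+ m.+1)) trmx_inv trmx_exp.
Qed.

Lemma sqn_shift (R : realType) n (k : int) (u : 'cV[R]_n.+1) :
  sqn (shift_mx R n ^ k *m u) = sqn u.
Proof.
rewrite /sqn dot_mull shift_mxz_tr mulmxA mulmxE -exprzDr ?shift_mx_unit //.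
by rewrite addNr expr0z mul1mx.
Qed.

(** The transpose of S^k is S^-k; hence a stencil enters its quadratic form only through the sums of
    its coefficients at k and -k. *)
Lemma dot_shiftN (R : realType) n (k : int) (u : 'cV[R]_n.+1) :
  dot u (shift_mx R n ^ (- k) *m u) = dot u (shift_mx R n ^ k *m u).
Proof. by rewrite -shift_mxz_tr -dot_mull dotC. Qed.

(** * The difference operator D = 1 - S and general stencil matrices *)

Definition diff_mx (R : realType) n : 'M[R]_n.+1 := 1 - shift_mx R n.

(** Common form of [A_mx] and [B_mx], which are instances of it by conversion. *)
Definition stencil_mx (R : realType) n (l r : nat) (c : int -> R) : 'M[R]_n.+1 :=
  stencil_sum l r (fun k => c k *: shift_mx R n ^ k).

Lemma stencil_mx_comm (R : realType) n l r (c : int -> R) (A : 'M[R]_n.+1) :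
  GRing.comm A (shift_mx R n) -> GRing.comm A (stencil_mx n l r c).
Proof.
move=> Ac; apply: commr_sum => i _.
by rewrite -mul_scalar_mx; apply: commrM; [exact/comm_mx_scalar | exact: commrXz].
Qed.

Lemma stencil_mx_tr_comm (R : realType) n l r (c : int -> R) :
  GRing.comm (shift_mx R n) (stencil_mx n l r c)^T.
Proof.
rewrite /stencil_mx raddf_sum; apply: commr_sum => i _ /=.
rewrite linearZ /= shift_mxz_tr -mul_scalar_mx.
by apply: commrM; [exact/comm_mx_scalar | exact: commrXz].
Qed.

Lemma dot_stencil_mx (R : realType) n l r (c : int -> R) (u : 'cV[R]_n.+1) :
  dot u (stencil_mx n l r c *m u) =
  stencil_sum l r (fun k => c k * dot u (shift_mx R n ^ k *m u)).
Proof.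
rewrite mulmx_suml dot_sumr; apply: eq_bigr => i _.
by rewrite -scalemxAl dotZr.
Qed.

Lemma sqn_diff (R : realType) n (u : 'cV[R]_n.+1) :
  sqn (diff_mx R n *m u) <= 4 * sqn u.
Proof.
rewrite mulmxBl mul1mx; apply: (le_trans (sqnD_le _ _)).
by rewrite sqnN -[shift_mx R n]expr1z sqn_shift; lra.
Qed.

(** Negative k reduce to positive ones, as S^-m u - u = - S^-m (S^m u - u) and S is an isometry. For
    k >= 0, S^(m+1) u - u = S (S^m u - u) - D u; the crude constant absorbs 2 * 4^m + 2 <=
    4^(m+1). *)
Lemma sqn_shift_sub (R : realType) n (k : int) (u : 'cV[R]_n.+1) :
  sqn (shift_mx R n ^ k *m u - u) <= 4 ^+ absz k * sqn (diff_mx R n *m u).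
Proof.
wlog [m ->] : k / exists m : nat, k = m%:Z.
  case: (intP k) => [|m|m] H; try by apply: H; eexists.
  have -> : shift_mx R n ^ (- m.+1%:Z) *m u - u =
      - (shift_mx R n ^ (- m.+1%:Z) *m (shift_mx R n ^ m.+1%:Z *m u - u)).
    rewrite mulmxBr mulmxA mulmxE -exprzDr ?shift_mx_unit //.
    by rewrite addNr expr0z mul1mx opprB.
  by rewrite sqnN sqn_shift abszN; apply: H; eexists.
elim: m => [|m IH].
  by rewrite expr0z mul1mx subrr expr0 mul1r -(scale0r 0) sqnZ expr0n mul0r sqn_ge0.
have -> : shift_mx R n ^ m.+1%:Z *m u - u =
    shift_mx R n ^ 1 *m (shift_mx R n ^ m%:Z *m u - u) - diff_mx R n *m u.
  rewrite /diff_mx expr1z mulmxBr mulmxBl mul1mx mulmxA mulmxE -exprSz.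
  by rewrite opprB addrA subrK.
apply: (le_trans (sqnD_le _ _)); rewrite sqnN sqn_shift.
have : (1 : R) <= 4 ^+ m by rewrite exprn_ege1 // ler1n.
move: IH; rewrite /= exprS; have := sqn_ge0 (diff_mx R n *m u); nra.
Qed.

(** Since the coefficients sum to 0, each S^k u may be replaced by S^k u - u, which is controlled by
    D u. *)
Lemma sqn_stencil_le (R : realType) l r (c : int -> R) :
  stencil_sum l r c = 0 ->
  exists2 C : R, 0 <= C & forall n (u : 'cV[R]_n.+1),
    sqn (stencil_mx n l r c *m u) <= C * sqn (diff_mx R n *m u).
Proof.
move=> c0.
have [|C C0 hC] := @sqn_sum_le R (l + r).+1 (fun i => c (i%:Z - l%:Z))
  (fun i => 4 ^+ absz (i%:Z - l%:Z)); first by move=> i; rewrite exprn_ge0.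
exists C => // n u.
have -> : stencil_mx n l r c *m u = \sum_(i < (l + r).+1)
    c (i%:Z - l%:Z) *: (shift_mx R n ^ (i%:Z - l%:Z) *m u - u).
  under [RHS]eq_bigr do rewrite scalerBr.
  rewrite sumrB -scaler_suml -[X in X *: u]/(stencil_sum l r c) c0 scale0r subr0.
  by rewrite mulmx_suml; apply: eq_bigr => i _; rewrite scalemxAl.
apply: (hC _ (fun i => shift_mx R n ^ (i%:Z - l%:Z) *m u - u)) => i _.
exact: sqn_shift_sub.
Qed.

(* (1 - S^-1)(1 - S) = - S^-1 (1 - S)^2, so the binomial theorem applies. *)
Lemma sqn_diff_pow (R : realType) n (j : nat) (u : 'cV[R]_n.+1) :
  sqn (diff_mx R n ^+ j *m u) = stencil_sum j j
    (fun k => (-1) ^ k * 'C(j + j, absz (j%:Z + k))%:R *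
              dot u (shift_mx R n ^ k *m u)).
Proof.
rewrite -dot_stencil_mx /sqn dot_mull; congr (dot u _).
rewrite mulmxA; congr (_ *m u).
set S := shift_mx R n; set D := diff_mx R n.
have SU : S \is a GRing.unit := shift_mx_unit R n.
have DS : GRing.comm D S by apply: commr_sym; apply: commrB => //; apply: commr1.
have Dt : D^T = - S^-1 * D.
  rewrite /D /diff_mx linearB /= trmx1 -shift_mxV mulrBr mulr1 mulNr mulVr //.
  by rewrite opprK addrC.
rewrite trmx_exp Dt mulmxE exprMn_comm; last first.
  by apply/commr_sym/commrN/commrV.
rewrite -mulrA -exprD exprNn -mulrA /D /diff_mx exprBn_comm; last first.
  exact/commr_sym/commr1.
rewrite /stencil_mx /stencil_sum !mulr_sumr; apply: eq_bigr => i _.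
rewrite expr1n mulr1 -mulr_natr.
have -> : absz (j%:Z + (i%:Z - j%:Z)) = i :> nat by lia.
have sg (m : nat) (A : 'M[R]_n.+1) : (-1) ^+ m * A = (-1) ^+ m *: A.
  by rewrite -signr_odd -[in RHS]signr_odd mulr_sign scaler_sign.
have -> : shift_mx R n ^ (i%:Z - j%:Z) = S^-1 ^+ j * S ^+ i.
  by rewrite addrC exprzDr // exprVn exprnN.
have -> : (-1 : R) ^ (i%:Z - j%:Z) = (-1) ^+ j * (-1) ^+ i.
  by rewrite addrC expfzDr ?oppr_eq0 ?oner_eq0 // -exprnN -exprVn invrN invr1.
rewrite !sg -/S mulr_natr -scaler_nat -!scalerAr.
by rewrite !scalerA; congr (_ *: _); ring.
Qed.

(** * Factorial forms of the binomials and of the stencil coefficients *)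

Lemma signz_nat (R : realType) (k : nat) : (-1 : R) ^ k%:Z = (-1) ^+ k.
Proof. by []. Qed.

Lemma signz_oppnat (R : realType) (k : nat) : (-1 : R) ^ (- k%:Z) = (-1) ^+ k.
Proof. by rewrite -exprnN -exprVn invrN invr1. Qed.

Lemma fact_gt0r (R : realType) (n : nat) : 0 < n`!%:R :> R.
Proof. by rewrite ltr0n fact_gt0. Qed.

Lemma factSr (R : realType) (n : nat) : n.+1`!%:R = (1 + n%:R) * n`!%:R :> R.
Proof. by rewrite factS natrM -natr1 addrC. Qed.

Lemma binr_sym (R : realType) (l k : nat) : (k <= l)%N ->
  'C(l + l, l + k)%:R = (l + l)`!%:R / ((l + k)`!%:R * (l - k)`!%:R) :> R.
Proof.
move=> kl; have h : (l + k <= l + l)%N by rewrite leq_add2l.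
by rewrite -(bin_fact h) subnDl !natrM mulfK //.
Qed.

(** Offsets k and -k are merged, having equal binomials and equal correlations <u, S^k u>. Binomials
    become factorial quotients, the shape of a_k and b_k. *)
Lemma sqn_diff_powE (R : realType) n (j : nat) (u : 'cV[R]_n.+1)
    (t := fun k : nat => dot u (shift_mx R n ^ k%:Z *m u)) :
  sqn (diff_mx R n ^+ j *m u) = (j + j)`!%:R / (j`!%:R * j`!%:R) * t 0 +
    2 * \sum_(1 <= k < j.+1)
          (-1) ^+ k * ((j + j)`!%:R / ((j + k)`!%:R * (j - k)`!%:R)) * t k.
Proof.
rewrite sqn_diff_pow stencil_sum_split -addrA; congr (_ + _).
  rewrite expr0z mul1r addr0 [absz _]/= -[in X in 'C(_, X)](addn0 j).
  by rewrite binr_sym // addn0 subn0.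
rewrite -big_split mulr_sumr; apply: eq_big_nat => k /andP[k0 kj] /=.
rewrite signz_nat signz_oppnat dot_shiftN -/(t k).
have -> : absz (j%:Z - k%:Z) = (j - k)%N by lia.
have -> : 'C(j + j, j - k) = 'C(j + j, j + k).
  by rewrite -bin_sub; [congr 'C(_, _); lia | lia].
rewrite binr_sym //; ring.
Qed.

Lemma a_coef_pos (R : realType) (l r k : nat) : (0 < k <= r)%N ->
  a_coef R l r k%:Z = - ((-1) ^+ k / k%:R *
    (l`!%:R * r`!%:R / ((l + k)`!%:R * (r - k)`!%:R))).
Proof.
move=> /andP[k0 kr]; rewrite /a_coef ifF; last by lia.
rewrite mulNr signz_nat; congr (- (_ * (_ / (_ * _`!%:R)))).
lia.
Qed.

Lemma a_coef_neg (R : realType) (l r k : nat) : (0 < k <= l)%N ->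
  a_coef R l r (- k%:Z) = (-1) ^+ k / k%:R *
    (l`!%:R * r`!%:R / ((l - k)`!%:R * (r + k)`!%:R)).
Proof.
move=> /andP[k0 kl]; rewrite /a_coef ifF; last by lia.
rewrite signz_oppnat mulrNz invrN mulrN opprK.
by congr (_ * (_ / (_`!%:R * _`!%:R))); lia.
Qed.

(** Opposite reciprocals leave a difference of harmonic numbers: 1/(r+1) when l = r+1, and 1/(r+1) +
    1/(r+2) when l = r+2. *)
Lemma a_coef0 (R : realType) (l r : nat) : a_coef R l r 0 =
  \sum_(1 <= k < l.+1) k%:R^-1 - \sum_(1 <= k < r.+1) k%:R^-1.
Proof.
rewrite /a_coef eqxx stencil_sum_split eqxx add0r opprD addrC; congr (_ - _).
  rewrite -sumrN; apply: eq_big_nat => k /andP[k0 _].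
  by rewrite ifF ?mulrNz ?invrN ?opprK //; lia.
by apply: eq_big_nat => k /andP[k0 _]; rewrite ifF //; lia.
Qed.

Lemma b_coef_nat (R : realType) (q k : nat) : (0 < k <= q)%N ->
  b_coef R q k%:Z = - (2 * (-1) ^+ k / k%:R ^+ 2 *
    (q`!%:R * q`!%:R / ((q + k)`!%:R * (q - k)`!%:R))).
Proof.
move=> /andP[k0 kq]; rewrite /b_coef ifF; last by lia.
rewrite mulNr signz_nat; congr (- (_ * (_ / (_ * _`!%:R)))); lia.
Qed.

Lemma b_coef_oppnat (R : realType) (q k : nat) : (0 < k <= q)%N ->
  b_coef R q (- k%:Z) = b_coef R q k%:Z.
Proof.
move=> /andP[k0 kq]; rewrite /b_coef !ifF; [|lia|lia].
rewrite signz_oppnat signz_nat mulrNz sqrrN [in LHS](mulrC (absz _)`!%:R).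
by congr (_ * (_ / (_`!%:R * _`!%:R))); lia.
Qed.

(** * Coefficient identities behind the two quadratic forms *)

(** Over the denominator (l+k)! (l-k)!, the sum a_k + a_-k has numerator (-1)^k l! r! / k times
    (l+k) - (l-k) = 2k if l = r+1, or times (l+k)(l+k-1) - (l-k)(l-k-1) = 2k (2l-1) if l = r+2. The
    factor k cancels, leaving a multiple of the coefficients of |D^l u|^2. *)
Lemma a_coef_form (R : realType) (l r : nat) : l = r.+1 \/ l = r.+2 ->
  exists2 c : R, 0 <= c & forall t : nat -> R,
    a_coef R l r 0 * t 0 + \sum_(1 <= k < r.+1) a_coef R l r k%:Z * t k
      + \sum_(1 <= k < l.+1) a_coef R l r (- k%:Z) * t k =
    c * ((l + l)`!%:R / (l`!%:R * l`!%:R) * t 0 + 2 * \sum_(1 <= k < l.+1)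
      (-1) ^+ k * ((l + l)`!%:R / ((l + k)`!%:R * (l - k)`!%:R)) * t k).
Proof.
move=> hl.
pose c : R := (if l == r.+1 then 1 else (l + l)%:R - 1) *
  (l`!%:R * r`!%:R / (l + l)`!%:R).
have gt := fact_gt0r R.
have ge n : 0 <= n%:R :> R by [].
have r0 := ge r.
(* Here -k has no mirror image in the stencil. The paired formula persists because the missing term
   would carry the factor l-k, respectively (l-k)(l-k-1), which vanishes. *)
have hneg k : (r < k <= l)%N -> a_coef R l r (- k%:Z) =
    c * (2 * ((-1) ^+ k * ((l + l)`!%:R / ((l + k)`!%:R * (l - k)`!%:R)))).
  move=> /andP[rk kl]; rewrite a_coef_neg ?kl ?andbT ?(leq_ltn_trans _ rk) //.
  rewrite /c; have := gt (l + l)%N; move: (l + l)`!%:R => LL LL0.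
  have := gt l; move: l`!%:R => L L0; have := gt r; move: r`!%:R => F F0.
  have := gt (r + r)%N; case: hl => ?; subst l.
    have -> : k = r.+1 by lia.
    rewrite eqxx subnn fact0 addSn addnS !factSr -natr1 natrD.
    move: (r + r)`!%:R => Y Y0; field.
    by rewrite !gt_eqF //; nra.
  rewrite ifF; last by lia.
  have : k = r.+1 \/ k = r.+2 by lia.
  have -> : (r.+2 + r.+2)%:R = r%:R + r%:R + 4 :> R by rewrite natrD -!natr1; ring.
  case=> ->.
    have -> : (r.+2 - r.+1)%N = 1%N by lia.
    rewrite !addSn !addnS !factSr fact0 -!natr1 natrD.
    move: (r + r)`!%:R => Y Y0; field.
    by rewrite !gt_eqF //; nra.
  rewrite subnn fact0 !addSn !addnS !factSr -!natr1 natrD.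
  move: (r + r)`!%:R => Y Y0; field.
  by rewrite !gt_eqF //; nra.
have hpos k : (0 < k <= r)%N -> a_coef R l r k%:Z + a_coef R l r (- k%:Z) =
    c * (2 * ((-1) ^+ k * ((l + l)`!%:R / ((l + k)`!%:R * (l - k)`!%:R)))).
  move=> /andP[k0 kr]; rewrite a_coef_pos ?k0 //.
  rewrite a_coef_neg ?k0; last by case: hl => ->; lia.
  rewrite /c; have := gt (l + l)%N; move: (l + l)`!%:R => LL LL0.
  (* With r = k + p, the factorials of l+k, l-k, r+k and r-k are explicit multiples of (2k+p)! or
     p!, so the identity becomes rational. *)
  have [p rE] : exists p, r = (k + p)%N by exists (r - k)%N; lia.
  have := gt l; move: l`!%:R => L L0; have := gt r; move: r`!%:R => F F0.
  have p0 := ge p; have k0R : 0 < k%:R :> R by rewrite ltr0n.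
  have -> : (r - k = p)%N by lia.
  have -> : (r + k = k + k + p)%N by lia.
  case: hl => ?; subst l r.
    have -> : ((k + p).+1 - k = p.+1)%N by lia.
    have -> : ((k + p).+1 + k = (k + k + p).+1)%N by lia.
    rewrite eqxx !factSr !natrD.
    have := gt p; have := gt (k + k + p)%N; move: (k + k + p)`!%:R p`!%:R.
    move=> X Y X0 Y0; field.
    by rewrite !gt_eqF //; nra.
  have -> : ((k + p).+2 - k = p.+2)%N by lia.
  have -> : ((k + p).+2 + k = (k + k + p).+2)%N by lia.
  rewrite ifF; last by lia.
  rewrite !factSr -!natr1 !natrD -!natr1 !natrD.
  have := gt p; have := gt (k + k + p)%N; move: (k + k + p)`!%:R p`!%:R.
  move=> X Y X0 Y0; field.
  by rewrite !gt_eqF //; nra.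
exists c.
  apply: mulr_ge0; last by rewrite divr_ge0 ?mulr_ge0 ?ltW.
  by case: ifP => // _; rewrite subr_ge0 ler1n; case: hl => ->.
move=> t; have rl : (r.+1 <= l.+1)%N by case: hl => ->; lia.
rewrite !(@big_cat_nat _ _ _ r.+1 1 l.+1) //=.
have -> : \sum_(r.+1 <= k < l.+1) a_coef R l r (- k%:Z) * t k =
    c * (2 * \sum_(r.+1 <= k < l.+1)
      (-1) ^+ k * ((l + l)`!%:R / ((l + k)`!%:R * (l - k)`!%:R)) * t k).
  rewrite !mulr_sumr; apply: eq_big_nat => k /andP[rk kl].
  by rewrite hneg ?rk // !mulrA.
rewrite -addrA [X in _ + X]addrA -big_split /=.
have -> : \sum_(1 <= k < r.+1)
    (a_coef R l r k%:Z * t k + a_coef R l r (- k%:Z) * t k) =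
    c * (2 * \sum_(1 <= k < r.+1)
      (-1) ^+ k * ((l + l)`!%:R / ((l + k)`!%:R * (l - k)`!%:R)) * t k).
  rewrite !mulr_sumr; apply: eq_big_nat => k /andP[rk kl].
  by rewrite -mulrDl hpos ?rk // !mulrA.
suff -> : a_coef R l r 0 = c * ((l + l)`!%:R / (l`!%:R * l`!%:R)) by ring.
rewrite a_coef0 /c; have := gt (l + l)%N; move: (l + l)`!%:R => LL LL0.
case: hl => ?; subst l; rewrite [\sum_(1 <= k < _.+2) _]big_nat_recr //=.
  rewrite eqxx !factSr; have := gt r; move: r`!%:R => F F0.
  rewrite -natr1; field.
  by rewrite !gt_eqF //; nra.
rewrite [\sum_(1 <= k < _.+2) _]big_nat_recr //= ifF; last by lia.
rewrite !factSr; have := gt r; move: r`!%:R => F F0.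
rewrite natrD -!natr1; field.
by rewrite !gt_eqF //; nra.
Qed.

(** The weights are the Taylor coefficients of 4 arcsin(x/2)^2 in powers of x^2. As D^T D has symbol
    x^2 with x = 2 sin(theta/2), the sum truncates the expansion of theta^2. By induction on q,
    widening the stencil adds exactly the term j = q+1. *)
Lemma b_coef_form (R : realType) (q : nat) (t : nat -> R) :
    b_coef R q 0 * t 0 + \sum_(1 <= k < q.+1) b_coef R q k%:Z * t k
      + \sum_(1 <= k < q.+1) b_coef R q (- k%:Z) * t k =
    - \sum_(1 <= j < q.+1) 2 * (j.-1`!%:R ^+ 2 / (j + j)`!%:R) *
     ((j + j)`!%:R / (j`!%:R * j`!%:R) * t 0 + 2 * \sum_(1 <= k < j.+1)
      (-1) ^+ k * ((j + j)`!%:R / ((j + k)`!%:R * (j - k)`!%:R)) * t k).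
Proof.
have gt := fact_gt0r R.
have ge n : 0 <= n%:R :> R by [].
suff E : b_coef R q 0 * t 0 + 2 * \sum_(1 <= k < q.+1) b_coef R q k%:Z * t k =
    - \sum_(1 <= j < q.+1) 2 * (j.-1`!%:R ^+ 2 / (j + j)`!%:R) *
     ((j + j)`!%:R / (j`!%:R * j`!%:R) * t 0 + 2 * \sum_(1 <= k < j.+1)
      (-1) ^+ k * ((j + j)`!%:R / ((j + k)`!%:R * (j - k)`!%:R)) * t k).
  rewrite -E -addrA; congr (_ + _); rewrite mulr_natl mulr2n; congr (_ + _).
  by apply: eq_big_nat => k /andP[k0 kq]; rewrite b_coef_oppnat ?k0.
elim: q => [|q IH].
  by rewrite !big_nil /b_coef eqxx big_nil oppr0 mul0r mulr0 addr0.
rewrite [in RHS]big_nat_recr //= opprD -IH.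
have b0 : b_coef R q.+1 0 = b_coef R q 0 - 2 / (1 + q%:R) ^+ 2.
  by rewrite /b_coef eqxx big_nat_recr //= opprD nat1r.
have hb k : (0 < k <= q)%N -> b_coef R q.+1 k%:Z = b_coef R q k%:Z -
    2 * (q`!%:R ^+ 2 / (q.+1 + q.+1)`!%:R) * ((-1) ^+ k *
    ((q.+1 + q.+1)`!%:R / ((q.+1 + k)`!%:R * (q.+1 - k)`!%:R))).
  move=> /andP[k0 kq]; rewrite !b_coef_nat ?k0 ?(leqW kq) //.
  have := gt (q.+1 + q.+1)%N; move: (q.+1 + q.+1)`!%:R => LL LL0.
  have [p rE] : exists p, q = (k + p)%N by exists (q - k)%N; lia.
  rewrite addSn subSn // !factSr; have := gt q; move: q`!%:R => F F0.
  have p0 := ge p; have k0R : 0 < k%:R :> R by rewrite ltr0n.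
  have -> : (q - k = p)%N by lia.
  rewrite rE !natrD; have := gt p; have := gt (k + p + k)%N.
  move: (k + p + k)`!%:R p`!%:R => X Y X0 Y0; field.
  by rewrite !gt_eqF //; nra.
(* The outermost offset is new, so its whole coefficient comes from the added term. *)
have hq : b_coef R q.+1 q.+1%:Z =
    - (2 * (q`!%:R ^+ 2 / (q.+1 + q.+1)`!%:R) * ((-1) ^+ q.+1 *
    ((q.+1 + q.+1)`!%:R / ((q.+1 + q.+1)`!%:R * (q.+1 - q.+1)`!%:R)))).
  rewrite b_coef_nat ?ltnSn //; have := gt (q.+1 + q.+1)%N.
  move: (q.+1 + q.+1)`!%:R => LL LL0; rewrite subnn fact0 !factSr -natr1.
  have := gt q; move: q`!%:R => F F0; have q0 := ge q; field.
  by rewrite !gt_eqF //; nra.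
rewrite [in LHS]big_nat_recr //= hq [\sum_(1 <= k < q.+2) _ in RHS]big_nat_recr //=.
have -> : \sum_(1 <= k < q.+1) b_coef R q.+1 k%:Z * t k =
    \sum_(1 <= k < q.+1) b_coef R q k%:Z * t k -
    2 * (q`!%:R ^+ 2 / (q.+1 + q.+1)`!%:R) * \sum_(1 <= k < q.+1) (-1) ^+ k *
    ((q.+1 + q.+1)`!%:R / ((q.+1 + k)`!%:R * (q.+1 - k)`!%:R)) * t k.
  rewrite mulr_sumr -sumrB; apply: eq_big_nat => k /andP[k0 kq].
  by rewrite hb ?k0 //; ring.
rewrite b0.
have -> : 2 / (1 + q%:R) ^+ 2 = 2 * (q`!%:R ^+ 2 / (q.+1 + q.+1)`!%:R) *
    ((q.+1 + q.+1)`!%:R / (q.+1`!%:R * q.+1`!%:R)) :> R.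
  have := gt (q.+1 + q.+1)%N.
  move: (q.+1 + q.+1)`!%:R => LL LL0; rewrite !factSr.
  have := gt q; move: q`!%:R => F F0; have q0 := ge q; field.
  by rewrite !gt_eqF //; nra.
ring.
Qed.

(** * Energy identities and consistency of the stencils *)

Lemma dot_A_mx (R : realType) (l r : nat) : l = r.+1 \/ l = r.+2 ->
  exists2 c : R, 0 <= c & forall n (u : 'cV[R]_n.+1),
    dot u (A_mx R l r n *m u) = c * sqn (diff_mx R n ^+ l *m u).
Proof.
move=> /(a_coef_form R)[c c0 cE]; exists c => // n u.
rewrite dot_stencil_mx sqn_diff_powE -cE stencil_sum_split.
by congr (_ + _); apply: eq_bigr => k _; rewrite dot_shiftN.
Qed.

Lemma dot_B_mx (R : realType) (q n : nat) (u : 'cV[R]_n.+1) :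
  dot u (B_mx R q n *m u) = - \sum_(1 <= j < q.+1)
    2 * (j.-1`!%:R ^+ 2 / (j + j)`!%:R) * sqn (diff_mx R n ^+ j *m u).
Proof.
under [in RHS]eq_bigr do rewrite sqn_diff_powE.
rewrite -b_coef_form dot_stencil_mx stencil_sum_split.
by congr (_ + _); apply: eq_bigr => k _; rewrite dot_shiftN.
Qed.

(** The term j = 1 has weight 2 (0!)^2 / 2! = 1; the others only add dissipation. *)
Lemma dot_B_mx_le (R : realType) (q n : nat) (u : 'cV[R]_n.+1) : (0 < q)%N ->
  dot u (B_mx R q n *m u) <= - sqn (diff_mx R n *m u).
Proof.
move=> q0; rewrite dot_B_mx lerN2 big_ltn // expr1 expr1n.
have -> : (1 + 1)`! = 2 by [].
rewrite mul1r divff // mul1r lerDl sumr_ge0 // => j _.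
by rewrite mulr_ge0 ?sqn_ge0 // mulr_ge0 // divr_ge0 // sqr_ge0.
Qed.

(* On the one-cell grid the shift is the identity and D = 0, so the stencil
   applied to the vector 1 is the sum of its coefficients. *)
Lemma stencil_mx_one_cell (R : realType) l r (c : int -> R)
    (e : 'cV[R]_1 := const_mx 1) :
  dot e (stencil_mx 0 l r c *m e) = stencil_sum l r c.
Proof.
rewrite dot_stencil_mx; apply: eq_stencil_sum => k _.
have -> : shift_mx R 0 = 1.
  by apply/matrixP => i j; rewrite !mxE !ord1.
by rewrite exp1rz mul1mx dotE big_ord1 !mxE !mulr1.
Qed.

Lemma diff_mx_one_cell (R : realType) : diff_mx R 0 = 0.
Proof. by apply/matrixP => i j; rewrite !mxE !ord1 subrr. Qed.

(** Consistency is read off the energy identity on the one-cell grid: D = 0 and l > 0 make its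
    right-hand side vanish. *)
Lemma a_coef_sum (R : realType) (l r : nat) : l = r.+1 \/ l = r.+2 ->
  stencil_sum l r (a_coef R l r) = 0.
Proof.
move=> hl; have [c _ cE] := dot_A_mx R hl.
rewrite -stencil_mx_one_cell; apply: (etrans (cE _ _)).
rewrite diff_mx_one_cell expr0n.
have -> : (l == 0%N) = false by case: hl => ->.
by rewrite mul0mx /sqn /dot mulmx0 mxE mulr0.
Qed.

Lemma b_coef_sum (R : realType) (q : nat) : stencil_sum q q (b_coef R q) = 0.
Proof.
rewrite -stencil_mx_one_cell; apply: (etrans (dot_B_mx _ _)).
rewrite big_nat big1 ?oppr0 // => j /andP[j0 _].
by rewrite diff_mx_one_cell expr0n gtn_eqF // mul0mx /sqn /dot mulmx0 mxE mulr0.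
Qed.

(** * Normality, step size restrictions and stability *)

(** Both M and its transpose are combinations of powers of S. *)
Lemma M_mx_normal (R : realType) (l r q n : nat) (nu h : R) :
  GRing.comm (M_mx l r q n nu h) (M_mx l r q n nu h)^T.
Proof.
have tr_comm : GRing.comm (shift_mx R n) (M_mx l r q n nu h)^T.
  rewrite /M_mx linearD linearN linearZ /=; apply: commrD.
    exact/commrN/stencil_mx_tr_comm.
  rewrite -mul_scalar_mx; apply: commrM; first exact/comm_mx_scalar.
  exact: stencil_mx_tr_comm.
apply: commr_sym; apply: commrD.
  apply: commrN; exact/stencil_mx_comm/commr_sym.
rewrite -mul_scalar_mx; apply: commrM; first exact/comm_mx_scalar.
exact/stencil_mx_comm/commr_sym.
Qed.

(** The bracket bounds |M u|^2 / |D u|^2, with rho = nu/h. The first conclusion makes mu M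
    contracting, since |D u|^2 <= 4 |u|^2; the second lets the dissipation 2 mu rho |D u|^2 absorb K
    |mu M u|^2. *)
Lemma step_size_bounds (R : realFieldType) (K Ca Cb mu rho : R) :
  3 <= K -> 0 <= Ca -> 0 <= Cb -> 0 < mu -> 0 < rho ->
  2 * K * (Ca + 1) * mu < rho ->
  (4 * (Ca + 1) + 4 * K * (Cb + 1) * rho) * mu < 1 ->
  mu ^+ 2 * (2 * Ca + 2 * rho ^+ 2 * Cb) <= 4^-1 /\
  K * mu * (2 * Ca + 2 * rho ^+ 2 * Cb) <= 2 * rho.
Proof.
move=> K3 Ca0 Cb0 mu0 rho0 muCa dth.
have K0 : 0 < K by lra.
have rm0 : 0 < rho * mu by rewrite mulr_gt0.
have p1 : 0 <= mu * Ca by rewrite mulr_ge0 // ltW.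
have p2 : 0 <= rho * mu * Cb by rewrite mulr_ge0 // ltW.
have p3 : 0 <= K * (rho * mu) by rewrite mulr_ge0 ?ltW.
have p4 : 0 <= K * (rho * mu * Cb) by rewrite mulr_ge0 // ltW.
have p5 : 0 <= K * mu by rewrite mulr_ge0 ?ltW.
have a1 : 4 * (mu * Ca) + 4 * mu <= 1 by lra.
have b1 : 4 * (K * (rho * mu * Cb)) <= 1 by lra.
have b2 : 3 * (rho * mu * Cb) <= K * (rho * mu * Cb) by rewrite ler_wpM2r.
have b3 : 3 * (rho * mu) <= K * (rho * mu) by rewrite ler_wpM2r // ltW.
have b4 : 12 * (rho * mu) + 12 * (rho * mu * Cb) <= 1 by lra.
split.
  (* The summands 1 in [Ca + 1] and [Cb + 1] serve here: they bound mu and rho mu themselves. *)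
  have q1 : mu * (mu * Ca) <= 4^-1 * 4^-1.
    by apply: ler_pM => //; rewrite ?ltW //; lra.
  have q2 : rho * mu * (rho * mu * Cb) <= 12^-1 * 12^-1.
    by apply: ler_pM => //; rewrite ?ltW //; lra.
  by lra.
have q3 : rho * (4 * (K * (rho * mu * Cb))) <= rho * 1 by rewrite ler_wpM2l // ltW.
by lra.
Qed.

Theorem theorem4p1 (R : realType) (r l q m : nat) (rk : explicit_RK R)
  (hl : l = r.+1 \/ l = r.+2) (hq : (1 <= q)%N) (hm : (1 <= m)%N)
  (hrk : has_order rk m) :
  exists alpha0 beta0 gamma0 : R,
    [/\ 0 < alpha0, 0 < beta0, 0 < gamma0 &
     forall (nu : R) (n : nat) (dt : R),
       let N := n.+1 in
       let h : R := 1 / N%:R in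
       0 < nu -> 0 < dt ->
       dt < nu * gamma0 ->
       (alpha0 + nu * beta0 / h) * (dt / h) < 1 ->
       stable rk l r q n nu h dt].
Proof.
have [g gE] := stab_polyE rk.
have [G G0 hG] := sqn_horner_le g.
have [c c0 cE] := dot_A_mx R hl.
have [Ca Ca0 hA] := sqn_stencil_le (a_coef_sum R hl).
have [Cb Cb0 hB] := sqn_stencil_le (b_coef_sum R q).
pose K := 3 * (1 + G); have K3 : 3 <= K by rewrite /K; lra.
(* alpha_0 and beta_0 make mu M a contraction. In K |mu M u|^2, gamma_0 limits the share of A to
   half of the dissipation of B, and beta_0 limits the share of B to a quarter. *)
exists (4 * (Ca + 1)), (4 * K * (Cb + 1)), (2 * K * (Ca + 1))^-1.
split; [lra|nra|by rewrite invr_gt0; nra|].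
move=> nu n dt N h nu0 dt0 dtnu dth.
have h0 : 0 < h by rewrite /h divr_gt0 // ltr0n.
pose mu := dt / h; pose rho := nu / h.
have mu0 : 0 < mu by rewrite divr_gt0.
have rho0 : 0 < rho by rewrite divr_gt0.
have muCa : 2 * K * (Ca + 1) * mu < rho.
  rewrite /mu /rho mulrA ltr_pM2r ?invr_gt0 // mulrC.
  by rewrite -ltr_pdivlMr //; nra.
have {}dth : (4 * (Ca + 1) + 4 * K * (Cb + 1) * rho) * mu < 1.
  suff <- : nu * (4 * K * (Cb + 1)) / h = 4 * K * (Cb + 1) * rho by [].
  by rewrite /rho; ring.
have [h1 h2] := step_size_bounds K3 Ca0 Cb0 mu0 rho0 muCa dth.
apply: mx_norm_powers => u; rewrite gE -/mu -/rho.
set M := M_mx l r q n nu h.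
have hM v : sqn ((mu *: M) *m v) <=
    mu ^+ 2 * (2 * Ca + 2 * rho ^+ 2 * Cb) * sqn (diff_mx R n *m v).
  rewrite -scalemxAl sqnZ -mulrA ler_wpM2l ?sqr_ge0 //.
  rewrite /M /M_mx mulmxDl mulNmx -scalemxAl; apply: (le_trans (sqnD_le _ _)).
  rewrite sqnN sqnZ -/rho; have hAv := hA n v.
  have := ler_wpM2l (sqr_ge0 rho) (hB n v).
  by move: hAv; rewrite -/(A_mx R l r n) -/(B_mx R q n); lra.
have hM1 v : sqn ((mu *: M) *m v) <= sqn v.
  apply: (le_trans (hM v)).
  apply: (le_trans (ler_wpM2r (sqn_ge0 _) h1)).
  by rewrite mulrC ler_pdivrMr // mulrC sqn_diff.
have ZC : GRing.comm (mu *: M) (mu *: M)^T.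
  rewrite linearZ /= -!mul_scalar_mx.
  have sc A : GRing.comm mu%:M A by apply/commr_sym/comm_mx_scalar.
  apply: commrM; first exact/commr_sym/sc.
  exact/commr_sym/commrM/commr_sym/M_mx_normal/commr_sym/sc.
apply: le_trans (sqn_normal_step u ZC hM1 (hG _ _ hM1)) _.
rewrite -/K -addrA gerDl.
have K0 : 0 <= K by lra.
have hMu := ler_wpM2l K0 (hM u).
apply: (le_trans (lerD (lexx _) hMu)).
rewrite -scalemxAl dotZr /M /M_mx mulmxDl dotDr mulNmx dotNr cE.
rewrite -scalemxAl dotZr -/rho.
have := dot_B_mx_le u hq; have := sqn_ge0 (diff_mx R n ^+ l *m u).
have := sqn_ge0 (diff_mx R n *m u).
move: (dot u _) (sqn _) (sqn _) => b X Y X0 Y0 bX.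
(* What remains is linear: - 2 mu c |D^l u|^2 + 2 mu rho <u, B u> plus at most 2 mu rho |D u|^2 is
   nonpositive. *)
have := ler_wpM2r (mulr_ge0 (ltW mu0) X0) h2.
have := ler_wpM2l (mulr_ge0 (ltW mu0) (ltW rho0)) bX.
have := mulr_ge0 (ltW mu0) (mulr_ge0 c0 Y0).
by lra.
Qed.
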